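(* Let $a=(a_i)_{i\in\mathbb Z}$ be a sequence in $\Bbbk$. The $a$-shifted power sums $\Psi_{1;a},\Psi_{2;a},\Psi_{3;a},\ldots$ form a set of free generators of the associative $\Bbbk$-algebra $\mathrm{Sym}^a$.
   Context: $\Bbbk$ is a field of characteristic zero and $a=(a_i)_{i\in\mathbb Z}$ is a sequence in $\Bbbk$. Put $(t\downarrow a)^k=(t-a_1)\cdots(t-a_k)$, $(t\downarrow a)^0=1$, $(\tau^s a)_i=a_{i+s}$ for $s\in\mathbb Z$, and $\hat a_i=-a_{-i+1}$. $\mathrm{Sym}^a=\Bbbk\langle S_{1;a},S_{2;a},\ldots\rangle$ is the free associative unital $\Bbbk$-algebra on $S_{k;a}$, $k\ge1$. With $t$ a central variable and all expressions expanded as formal power series in $1/t$, put $\sigma^a(t)=\sum_{k\ge0}S_{k;a}/(t\downarrow a)^k$ and $\lambda^{\hat a}(t)=\sum_{k\ge0}\Lambda_{k;a}/(t\downarrow\hat a)^k$ with $S_{0;a}=\Lambda_{0;a}=1$; the elements $\Lambda_{k;a}\in\mathrm{Sym}^a$ are determined by $\lambda^{\hat a}(-t)\sigma^a(t)=\sigma^a(t)\lambda^{\hat a}(-t)=1$. Shifts: for $s\in\mathbb Z$, $S_{k;a}^{[s]}$ and $\Lambda_{k;a}^{[s]}$ are defined by $\sum_{k\ge0} S_{k;a}^{[s]}/(t\downarrow\tau^{-s}a)^k=\sum_{k\ge0}S_{k;a}/(t\downarrow a)^k$ and $\sum_{k\ge0}\Lambda_{k;a}^{[s]}/(t\downarrow\tau^{s}\hat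 a)^k=\sum_{k\ge0}\Lambda_{k;a}/(t\downarrow\hat a)^k$. The $a$-shifted power sums are $\Psi_{n;a}=\sum_{k=0}^{n-1}(-1)^k(n-k)\Lambda_{k;a}^{[n-k]}S_{n-k;a}^{[n-k-1]}$. *)

(* Defs.v *)
From HB Require Import structures.
From mathcomp Require Import all_boot all_order all_algebra.
From mathcomp Require Import finmap monalg.

Set Implicit Arguments.
Unset Strict Implicit.
Unset Printing Implicit Defensive.

Import GRing.Theory.
Local Open Scope ring_scope.

(* The free associative unital algebra K<x_i : i in I>: the monoid algebra of
   the free monoid on I.  It is a fresh constant because {malg R[M]} only has a
   canonical algType structure when the monoid M is commutative. *)
Definition freealg (K : fieldType) (I : choiceType) : Type :=
  {malg K[{fmonom I}]}.

Section FreeAlgebra.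
Variables (K : fieldType) (I : choiceType).

HB.instance Definition _ := GRing.Lalgebra.on (freealg K I).

Fact freealg_scaleAr (c : K) (x y : freealg K I) : c *: (x * y) = x * (c *: y).
Proof.
rewrite (malgMEw (fsubset_refl (msupp x)) (msuppZ_le c y)).
rewrite [x * y]malgME scaler_sumr; apply: eq_bigr => m _.
rewrite scaler_sumr; apply: eq_bigr => n _; apply/malgP => k.
by rewrite mcoeffZ !mcoeffU mcoeffZ mulrnAr mulrCA.
Qed.

HB.instance Definition _ :=
  GRing.Lalgebra_isAlgebra.Build K (freealg K I) freealg_scaleAr.

Definition fgen (i : I) : freealg K I := mkmalgU (fmu i) 1.

Variables (A : algType K) (x : I -> A).

Definition word_eval (m : {fmonom I}) : A := \prod_(i <- (m : seq I)) x i.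

(* The algebra morphism K<x_i> -> A sending the i-th generator to x i. *)
Definition freealg_eval (p : freealg K I) : A :=
  mmap (in_alg A) word_eval p.

(* The family x is a free generating family of the K-algebra A. *)
Definition free_generators : Prop := bijective freealg_eval.

Fact word_eval_mmorphism : mmorphism word_eval.
Proof.
by rewrite /word_eval; split=> [m n|]; rewrite ?fmM ?big_cat // fm1 big_nil.
Qed.

HB.instance Definition _ :=
  isMultiplicative.Build _ _ word_eval word_eval_mmorphism.

Lemma freealg_evalB : {morph freealg_eval : p q / p - q}.
Proof. by move=> p q; rewrite /freealg_eval raddfB. Qed.

Lemma freealg_evalM : {morph freealg_eval : p q / p * q}.
Proof.
apply: (commr_mmap_is_multiplicative (f := in_alg A) _).1 => g m m' /=.
by rewrite /GRing.comm mulr_algl mulr_algr.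
Qed.

Lemma freealg_eval1 : freealg_eval 1 = 1.
Proof. exact: mmap1. Qed.

Lemma freealg_evalZ c p : freealg_eval (c *: p) = c *: freealg_eval p.
Proof. by rewrite /freealg_eval mmapZ /= mulr_algl. Qed.

Lemma freealg_evalX i : freealg_eval (fgen i) = x i.
Proof. by rewrite /freealg_eval mmapU /= /word_eval fmU big_seq1 scale1r mul1r. Qed.

End FreeAlgebra.

(* Course-of-values recursion: crec F n = F n (crec F), where F n g may only
   use the values g k with k < n. *)
Section CourseOfValues.
Variables (T : nmodType) (F : nat -> (nat -> T) -> T).

Fixpoint crec_upto (n : nat) : nat -> T :=
  if n is m.+1 then
    fun k => if k == m then F m (crec_upto m) else crec_upto m k
  else fun _ => 0.

Definition crec (n : nat) : T := crec_upto n.+1 n.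

Lemma crecE :
  (forall n g h, (forall k, (k < n)%N -> g k = h k) -> F n g = F n h) ->
  forall n, crec n = F n crec.
Proof.
move=> Floc n; rewrite /crec /= eqxx; apply: Floc.
elim: n => // n IHn k; rewrite ltnS /= leq_eqVlt.
by case: (k =P n) => [->|_ /= kn]; [rewrite eqxx | exact: IHn].
Qed.

End CourseOfValues.

(* Formal power series in 1/t: f n is the coefficient of t^(-n).  The variable
   t is central, hence the Cauchy product also for noncommutative A. *)
Definition fps (A : Type) : Type := nat -> A.

Section PowerSeries.
Variable A : nzRingType.

Definition fps_one : fps A := fun n => (n == 0)%:R.

Definition fps_mul (f g : fps A) : fps A :=
  fun n => \sum_(i < n.+1) f i * g (n - i)%N.

(* f(t) |-> f(-t) *)
Definition fps_negt (f : fps A) : fps A := fun n => (-1) ^+ n * f n.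

(* The inverse of a series with constant term 1. *)
Definition fps_inv (f : fps A) : fps A :=
  crec (fun n g => (n == 0)%:R - \sum_(k < n) g k * f (n - k)%N).

Lemma fps_mulA f g h : fps_mul f (fps_mul g h) =1 fps_mul (fps_mul f g) h.
Proof.
move=> n; pose poly f := \poly_(i < n.+1) f i : {poly A}.
have coef_poly_mul u v m : (m <= n)%N -> (poly u * poly v)`_m = fps_mul u v m.
  move=> mn; rewrite coefM; apply: eq_bigr => i _.
  rewrite !coef_poly !ltnS (leq_trans (leq_subr _ _) mn).
  by rewrite (leq_trans _ mn) // -ltnS.
transitivity ((poly f * (poly g * poly h))`_n).
  rewrite coefM; apply: eq_bigr => i _.
  by rewrite coef_poly ltn_ord coef_poly_mul // leq_subr.
rewrite mulrA coefM; apply: eq_bigr => i _.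
by rewrite coef_poly_mul -1?ltnS // coef_poly ltnS leq_subr.
Qed.

Lemma fps_mul1 f : fps_mul f fps_one =1 f.
Proof.
move=> n; rewrite /fps_mul big_ord_recr /= subnn mulr1 big1 ?add0r // => i _.
by rewrite /fps_one subn_eq0 leqNgt ltn_ord mulr0.
Qed.

Lemma fps_1mul f : fps_mul fps_one f =1 f.
Proof.
move=> n; rewrite /fps_mul big_ord_recl /= subn0 mul1r big1 ?addr0 // => i _.
exact: mul0r.
Qed.

Lemma eq_fps_mul f f' g g' : f =1 f' -> g =1 g' -> fps_mul f g =1 fps_mul f' g'.
Proof. by move=> ff gg n; apply: eq_bigr => i _; rewrite ff gg. Qed.

Lemma fps_invE f n :
  fps_inv f n = (n == 0)%:R - \sum_(k < n) fps_inv f k * f (n - k)%N.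
Proof.
apply: (@crecE _ (fun n g => (n == 0)%:R - \sum_(k < n) g k * f (n - k)%N)).
by move=> m g h gh; congr (_ - _); apply: eq_bigr => k _; rewrite gh.
Qed.

Lemma fps_mulVf f : f 0%N = 1 -> fps_mul (fps_inv f) f =1 fps_one.
Proof.
move=> f0 n; rewrite /fps_mul big_ord_recr /= subnn f0 mulr1.
by rewrite [X in _ + X]fps_invE addrC subrK.
Qed.

Lemma fps_inv0 f : fps_inv f 0%N = 1.
Proof. by rewrite fps_invE big_ord0 subr0. Qed.

Lemma fps_mulfV f : f 0%N = 1 -> fps_mul f (fps_inv f) =1 fps_one.
Proof.
move=> f0; set g := fps_inv f; set h := fps_inv g.
have hg : fps_mul h g =1 fps_one by apply/fps_mulVf/fps_inv0.
have gf : fps_mul g f =1 fps_one by apply/fps_mulVf.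
have hf : h =1 f.
  move=> n; rewrite -[LHS]fps_mul1 -[RHS]fps_1mul.
  rewrite (eq_fps_mul (fun _ => erefl) (fun m => esym (gf m))) fps_mulA.
  exact: eq_fps_mul.
by move=> n; rewrite -hg; apply: eq_fps_mul => // m; rewrite hf.
Qed.

Lemma fps_negtK f : fps_negt (fps_negt f) =1 f.
Proof.
by move=> n; rewrite /fps_negt mulrA -exprD addnn -signr_odd odd_double mul1r.
Qed.

End PowerSeries.

Section ShiftedExpansions.
Variable K : fieldType.
Implicit Types (b : int -> K).

(* 1 / (t - c) = sum_(n >= 0) c^n t^(-n-1) *)
Definition inv_linear (c : K) : fps K := fun n => if n is m.+1 then c ^+ m else 0.

(* 1 / (t downarrow b)^k = 1 / ((t - b_1) ... (t - b_k)) *)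
Fixpoint inv_down b (k : nat) : fps K :=
  if k is m.+1 then fps_mul (inv_down b m) (inv_linear (b m.+1%:Z))
  else @fps_one K.

Lemma inv_down0 b k : inv_down b k.+1 0 = 0.
Proof. by rewrite /= /fps_mul big_ord1 mulr0. Qed.

(* (t - b_(k+1)) / (t downarrow b)^(k+1) = 1 / (t downarrow b)^k *)
Lemma inv_downS b k n :
  inv_down b k.+1 n.+1 - b k.+1%:Z * inv_down b k.+1 n = inv_down b k n.
Proof.
rewrite [inv_down b k.+1]/= /fps_mul; move: (inv_down b k) => g.
rewrite !big_ord_recr /= !subnn /= !mulr0 !addr0 subSnn /= mulr1 mulr_sumr.
rewrite addrAC -[RHS]add0r; congr (_ + _); rewrite -sumrB big1 // => i _.
rewrite subSn 1?ltnW //=; have : (0 < n - i)%N by rewrite subn_gt0.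
by case: (n - i)%N => //= j _; rewrite exprS mulrCA subrr.
Qed.

Lemma inv_down_lt b k n : (n < k)%N -> inv_down b k n = 0.
Proof.
elim: k n => // k IHk; elim=> [_|n IHn nk]; first exact: inv_down0.
have := inv_downS b k n; rewrite IHn ?(ltnW nk) // mulr0 subr0 => ->.
exact: IHk.
Qed.

Lemma inv_down_diag b n : inv_down b n n = 1.
Proof.
elim: n => // n IHn; have := inv_downS b n n.
by rewrite (inv_down_lt b (ltnSn n)) mulr0 subr0 => ->.
Qed.

Variable A : algType K.

(* sum_(k >= 0) c_k / (t downarrow b)^k; by inv_down_lt, the terms with k > n
   do not contribute to the coefficient of t^(-n). *)
Definition down_series b (c : nat -> A) : fps A :=
  fun n => \sum_(k < n.+1) inv_down b k n *: c k.

(* The coefficients c_k in the expansion f = sum_(k >= 0) c_k / (t downarrow b)^k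
   of a given series f; they exist and are unique by the next two lemmas. *)
Definition down_coef b (f : fps A) : nat -> A :=
  crec (fun n c => f n - \sum_(k < n) inv_down b k n *: c k).

Lemma down_coefE b f n :
  down_coef b f n = f n - \sum_(k < n) inv_down b k n *: down_coef b f k.
Proof.
apply: (@crecE _ (fun n c => f n - \sum_(k < n) inv_down b k n *: c k)).
by move=> m g h gh; congr (_ - _); apply: eq_bigr => k _; rewrite gh.
Qed.

Lemma down_coefK b f : down_series b (down_coef b f) =1 f.
Proof.
move=> n; rewrite /down_series big_ord_recr /= inv_down_diag scale1r.
by rewrite [X in _ + X]down_coefE addrC subrK.
Qed.

Lemma down_series_inj b c d : down_series b c =1 down_series b d -> c =1 d.
Proof.
move=> cd; elim/ltn_ind => n IHn; have := cd n.
rewrite /down_series !big_ord_recr /= inv_down_diag !scale1r.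
have -> : \sum_(k < n) inv_down b k n *: c k
          = \sum_(k < n) inv_down b k n *: d k.
  by apply: eq_bigr => k _; rewrite IHn.
exact: addrI.
Qed.

End ShiftedExpansions.

Section Sym.
Variables (K : fieldType) (a : int -> K).

Definition tau (s : int) (b : int -> K) : int -> K := fun i => b (i + s).

Definition hat (b : int -> K) : int -> K := fun i => - b (- i + 1).

(* The generator S_k, k >= 1, is the one of index k - 1 : nat. *)
Definition Sym : Type := freealg K nat.
HB.instance Definition _ := GRing.Algebra.on Sym.

Definition S_ (k : nat) : Sym := if k is j.+1 then fgen K j else 1.

Definition sigma : fps Sym := down_series a S_.

(* lambda(-t) is the inverse of sigma(t) *)
Definition Lambda : nat -> Sym := down_coef (hat a) (fps_negt (fps_inv sigma)).

Definition lambda : fps Sym := down_series (hat a) Lambda.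

Definition S_shift (s : int) : nat -> Sym := down_coef (tau (- s) a) sigma.

Definition Lambda_shift (s : int) : nat -> Sym :=
  down_coef (tau s (hat a)) lambda.

Definition Psi (n : nat) : Sym :=
  \sum_(k < n) (-1) ^+ k * (n - k)%:R *
     (Lambda_shift (n - k)%N k * S_shift ((n - k)%N%:Z - 1) (n - k)).

Lemma sigma0 : sigma 0%N = 1.
Proof. by rewrite /sigma /down_series big_ord1 scale1r. Qed.

Lemma lambda_negt : fps_negt lambda =1 fps_inv sigma.
Proof.
by move=> n; rewrite -[RHS]fps_negtK /fps_negt /lambda down_coefK.
Qed.

Lemma lambda_sigma : fps_mul (fps_negt lambda) sigma =1 @fps_one Sym.
Proof.
move=> n; rewrite (eq_fps_mul lambda_negt (fun _ => erefl)).
exact/fps_mulVf/sigma0.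
Qed.

Lemma sigma_lambda : fps_mul sigma (fps_negt lambda) =1 @fps_one Sym.
Proof.
move=> n; rewrite (eq_fps_mul (fun _ => erefl) lambda_negt).
exact/fps_mulfV/sigma0.
Qed.

Lemma Lambda0 : Lambda 0%N = 1.
Proof.
have := lambda_negt 0; rewrite fps_inv0 /fps_negt mul1r => <-.
by rewrite /lambda /down_series big_ord1 scale1r.
Qed.

Lemma S_shiftE s : down_series (tau (- s) a) (S_shift s) =1 down_series a S_.
Proof. exact: down_coefK. Qed.

Lemma Lambda_shiftE s :
  down_series (tau s (hat a)) (Lambda_shift s) =1 down_series (hat a) Lambda.
Proof. exact: down_coefK. Qed.

End Sym.

(* Main.v *)
Require Import Defs.
From HB Require Import structures.
From mathcomp Require Import all_boot all_order all_algebra.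
From mathcomp Require Import finmap monalg.

(** The change of generators from the S_k to the shifted power sums is
    triangular with invertible diagonal.  Expanding in another basis
    1 / (t downarrow b)^k only adds terms of smaller index, so S_n^[s] is S_n
    plus a linear combination of S_0, ..., S_(n-1), and Lambda_k^[s] is a
    polynomial in S_1, ..., S_k.  In the sum defining Psi_n only the term k = 0
    can therefore contain S_n, and
      Psi_n = n S_n + (a polynomial in S_1, ..., S_(n-1))
    ([Psi_triangular]).  In characteristic zero n is invertible, and such a
    system can be solved recursively for the S_n in terms of the Psi_n; the
    solution defines an endomorphism of the free algebra which is a two-sided
    inverse of the evaluation at the Psi_n ([triangular_free_generators]). *)

Set Implicit Arguments.
Unset Strict Implicit.
Unset Printing Implicit Defensive.

Import GRing.Theory.
Local Open Scope ring_scope.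

(** * Evaluation morphisms of free algebras *)

Section Evaluation.
Variables (K : fieldType) (I : choiceType).

Section Morphism.
Variables (A : algType K) (x : I -> A).

HB.instance Definition _ :=
  GRing.isZmodMorphism.Build (freealg K I) A (freealg_eval x)
    (freealg_evalB x).

HB.instance Definition _ :=
  GRing.isMonoidMorphism.Build (freealg K I) A (freealg_eval x)
    (freealg_eval1 x, freealg_evalM x).

Lemma freealg_evalD : {morph freealg_eval x : p q / p + q}.
Proof. exact: raddfD. Qed.

Lemma freealg_evalE p :
  freealg_eval x p = \sum_(m <- msupp p) p@_m *: word_eval x m.
Proof.
by rewrite /freealg_eval mmapE; apply: eq_bigr => m _; rewrite /= mulr_algl.
Qed.

Lemma eq_freealg_eval y : x =1 y -> freealg_eval x =1 freealg_eval y.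
Proof.
move=> xy p; rewrite /freealg_eval !mmapE; apply: eq_bigr => m _.
by congr (_ * _); apply: eq_bigr.
Qed.

End Morphism.

Lemma freealg_eval_comp (A : algType K) (x : I -> freealg K I) (y : I -> A) p :
  freealg_eval y (freealg_eval x p)
  = freealg_eval (fun i => freealg_eval y (x i)) p.
Proof.
rewrite [freealg_eval x p]freealg_evalE [RHS]freealg_evalE raddf_sum.
by apply: eq_bigr => m _; rewrite [LHS]freealg_evalZ rmorph_prod.
Qed.

(** Words are the monomial basis, so evaluation at the generators themselves
    returns the expansion of an element in that basis. *)
Lemma word_eval_fgen (m : {fmonom I}) :
  word_eval (fgen K (I := I)) m = mkmalgU m 1.
Proof.
rewrite /word_eval; case: m => s /=.
elim: s => [|i s IHs].
  by rewrite big_nil; congr mkmalgU; apply: val_inj; rewrite /= fm1.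
rewrite big_cons IHs.
rewrite [LHS](malgMEw msuppU_le msuppU_le) !big_seq_fset1 !mcoeffUU mulr1.
by congr mkmalgU; apply: val_inj; rewrite /= fmM fmU.
Qed.

Lemma freealg_eval_fgen p : freealg_eval (fgen K (I := I)) p = p.
Proof.
rewrite freealg_evalE [RHS]monalgE; apply: eq_bigr => m _.
rewrite word_eval_fgen; apply/malgP => k.
by rewrite [LHS]mcoeffZ [X in _ * X]mcoeffU [RHS]mcoeffU mulr_natr.
Qed.

End Evaluation.

(** * Triangular families of elements *)

Section Triangularity.
Variable K : fieldType.
Local Notation A := (freealg K nat).
Implicit Types (p q : A) (n : nat).

(** Membership in the subalgebra generated by the first n generators, stated as
    the dependence of evaluations on these generators only: stability under all
    algebra operations is then immediate, and it is the locality condition under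
    which a recursive definition through evaluation at p is well founded. *)
Definition in_first n p : Prop :=
  forall y z : nat -> A, (forall k, (k < n)%N -> y k = z k) ->
  freealg_eval y p = freealg_eval z p.

Lemma in_first_leq m n p : (m <= n)%N -> in_first m p -> in_first n p.
Proof. by move=> mn pm y z yz; apply: pm => k km; apply/yz/(leq_trans km). Qed.

Lemma in_first1 n : in_first n 1.
Proof. by move=> y z _; rewrite !rmorph1. Qed.

Lemma in_firstM n p q : in_first n p -> in_first n q -> in_first n (p * q).
Proof.
by move=> np nq y z yz; rewrite !freealg_evalM (np _ _ yz) (nq _ _ yz).
Qed.

Lemma in_firstZ n c p : in_first n p -> in_first n (c *: p).
Proof. by move=> np y z yz; rewrite !freealg_evalZ (np _ _ yz). Qed.

Lemma in_firstD n p q : in_first n p -> in_first n q -> in_first n (p + q).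
Proof.
by move=> np nq y z yz; rewrite !freealg_evalD (np _ _ yz) (nq _ _ yz).
Qed.

Lemma in_firstB n p q : in_first n p -> in_first n q -> in_first n (p - q).
Proof.
by move=> np nq y z yz; rewrite !freealg_evalB (np _ _ yz) (nq _ _ yz).
Qed.

Lemma in_first_sum n m (F : 'I_m -> A) :
  (forall i, in_first n (F i)) -> in_first n (\sum_i F i).
Proof.
by move=> nF y z yz; rewrite !raddf_sum /=; apply: eq_bigr => i _; apply: nF.
Qed.

Lemma in_first_nat n m : in_first n m%:R.
Proof. by move=> y z _; rewrite !rmorph_nat. Qed.

Lemma in_first_sign n m : in_first n ((-1) ^+ m).
Proof. by move=> y z _; rewrite !rmorph_sign. Qed.

Lemma in_first_gen n : in_first n.+1 (fgen K n).
Proof. by move=> y z yz; rewrite !freealg_evalX yz. Qed.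

(** The equations x_n = c_n X_n + p_n are solved for the X_n by recursion; since
    an algebra morphism is determined by its values on the generators, both
    composites of evaluation at the x_n with evaluation at the solutions are the
    identity because they fix the generators. *)
Lemma triangular_free_generators (x : nat -> A) (c : nat -> K) :
  (forall n, c n != 0) -> (forall n, in_first n (x n - c n *: fgen K n)) ->
  free_generators x.
Proof.
move=> c0 xn; set p := fun n => x n - c n *: fgen K n.
pose F n (g : nat -> A) : A := (c n)^-1 *: (fgen K n - freealg_eval g (p n)).
pose y := crec F.
have yE n : y n = (c n)^-1 *: (fgen K n - freealg_eval y (p n)).
  by apply: (@crecE A F) => m g h gh; rewrite /F (xn m g h gh).
have xE n : x n = c n *: fgen K n + p n by rewrite addrC subrK.
have yx n : freealg_eval y (x n) = fgen K n.
  rewrite xE freealg_evalD [X in X + _]freealg_evalZ freealg_evalX yE.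
  by rewrite scalerA divff // scale1r subrK.
have xy n : freealg_eval x (y n) = fgen K n.
  elim/ltn_ind: n => n IHn; rewrite yE [LHS]freealg_evalZ freealg_evalB.
  (* By induction the composite fixes the first n generators, hence p_n. *)
  rewrite freealg_evalX freealg_eval_comp (xn n _ _ IHn) freealg_eval_fgen.
  by rewrite /p subKr scalerA mulVf // scale1r.
have fix_gens u : u =1 fgen K (I := nat) -> forall q, freealg_eval u q = q.
  by move=> un q; rewrite (eq_freealg_eval un) freealg_eval_fgen.
exists (freealg_eval y) => q.
  by rewrite [LHS]freealg_eval_comp; apply: fix_gens _ yx _.
by rewrite [LHS]freealg_eval_comp; apply: fix_gens _ xy _.
Qed.

(** As S_k is the generator of index k - 1, a sequence is filtered when its n-th
    term is a polynomial in S_1, ..., S_n.  In this form triangularity passes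
    through all the series operations that lead from S_k to Lambda_k^[s]: each of
    them only uses terms of index at most n to form the n-th one. *)
Definition filtered (f : nat -> A) : Prop := forall n, in_first n (f n).

Lemma filtered_down_series b c : filtered c -> filtered (down_series b c).
Proof.
move=> cn n; apply: in_first_sum => k; apply: in_firstZ.
by apply: in_first_leq (cn k); rewrite -ltnS.
Qed.

Lemma filtered_down_coef b f : filtered f -> filtered (down_coef b f).
Proof.
move=> fn; elim/ltn_ind => n IHn; rewrite down_coefE.
apply: in_firstB (fn n) _; apply: in_first_sum => k; apply: in_firstZ.
exact: in_first_leq (ltnW _) (IHn k _).
Qed.

Lemma filtered_inv f : filtered f -> filtered (fps_inv f).
Proof.
move=> fn; elim/ltn_ind => n IHn; rewrite fps_invE.
apply: in_firstB; first exact: in_first_nat.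
apply: in_first_sum => k; apply: in_firstM.
  exact: in_first_leq (ltnW _) (IHn k _).
exact: in_first_leq (leq_subr _ _) (fn _).
Qed.

Lemma filtered_negt f : filtered f -> filtered (fps_negt f).
Proof.
move=> fn n; rewrite /fps_negt.
by apply: in_firstM (fn n); apply: in_first_sign.
Qed.

End Triangularity.

(** * Triangularity of the shifted power sums *)

Section PowerSums.
Variables (K : fieldType) (a : int -> K).

Lemma filtered_S : filtered (S_ K).
Proof. by case=> [|n]; [apply: in_first1 | apply: in_first_gen]. Qed.

Lemma filtered_sigma : filtered (sigma a).
Proof. exact/filtered_down_series/filtered_S. Qed.

Lemma filtered_S_shift s : filtered (S_shift a s).
Proof. exact/filtered_down_coef/filtered_sigma. Qed.

Lemma filtered_Lambda_shift s : filtered (Lambda_shift a s).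
Proof.
apply/filtered_down_coef/filtered_down_series/filtered_down_coef/filtered_negt.
exact/filtered_inv/filtered_sigma.
Qed.

Lemma Lambda_shift0 s : Lambda_shift a s 0 = 1.
Proof.
rewrite /Lambda_shift down_coefE big_ord0 subr0.
by rewrite /lambda /down_series big_ord1 scale1r Lambda0.
Qed.

(** Both expansions of sigma(t) give the same coefficient of t^(-n-1).  Each
    expresses it as the term of index n + 1 plus contributions of smaller index,
    because 1 / (t downarrow b)^(n+1) starts with t^(-n-1). *)
Lemma S_shift_triangular s n : in_first n (S_shift a s n.+1 - S_ K n.+1).
Proof.
rewrite /S_shift down_coefE {1}/sigma {1}/down_series big_ord_recr.
rewrite inv_down_diag scale1r addrAC addrK.
apply: in_firstB; apply: in_first_sum => k; apply: in_firstZ.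
  by apply: in_first_leq (@filtered_S k); rewrite -ltnS.
by apply: in_first_leq (@filtered_S_shift s k); rewrite -ltnS.
Qed.

(** For k >= 1 the summand of Psi_(n+1) involves Lambda_k^[s] and S_(n+1-k)^[s']
    with both indices at most n. *)
Lemma Psi_triangular n : in_first n (Psi a n.+1 - n.+1%:R *: fgen K n).
Proof.
rewrite /Psi big_ord_recl subn0 expr0 mul1r Lambda_shift0 mul1r.
rewrite mulr_natl -[X in X + _ - _]scaler_nat addrAC -scalerBr.
apply: in_firstD; first exact/in_firstZ/S_shift_triangular.
apply: in_first_sum => k; apply: in_firstM.
  by apply: in_firstM; [apply: in_first_sign | apply: in_first_nat].
apply: in_firstM.
  by apply: in_first_leq (@filtered_Lambda_shift _ _); rewrite lift0.
by apply: in_first_leq (@filtered_S_shift _ _); rewrite subSS leq_subr.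
Qed.

End PowerSums.

Theorem proposition37 (K : fieldType) (charK : [pchar K] =i pred0)
    (a : int -> K) :
  free_generators (fun n : nat => Psi a n.+1).
Proof.
apply: (triangular_free_generators (c := fun n => n.+1%:R)) => n.
  by rewrite ((pcharf0P K).1 charK).
exact: Psi_triangular.
Qed.
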